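(* Let $\mathcal A$ be a well-structured set of quantum assertions and $\mathrm{PS}$ a Hoare-type proof system for quantum while-programs with assertions from $\mathcal A$ as described in the context, and consider the abstract interpretation induced by $\mathrm{PS}$. (1) If $\mathrm{PS}$ is sound, then for every program $S$, $\llbracket S\rrbracket^\#$ is a sound abstraction of $\llbracket S\rrbracket$. (2) If $\mathrm{PS}$ is sound and relatively complete, then for every program $S$, $\llbracket S\rrbracket^\#$ is a complete abstraction of $\llbracket S\rrbracket$, i.e. $\alpha\circ\llbracket S\rrbracket=\llbracket S\rrbracket^\#\circ\alpha$ on $\mathcal Q$.
   Context: Fix a finite set $V$ of quantum variables, each a qubit with state space $\mathcal H_q\cong\mathbb C^2$; for $W\subseteq V$, $\mathcal H_W=\bigotimes_{q\in W}\mathcal H_q$. Operators and subspaces on $\mathcal H_W$ are identified with their cylindrical extensions to $\mathcal H_V$, and a subspace is identified with its orthogonal projector; $P^\perp$ is the orthocomplement. $\mathcal D(\mathcal H_V)$ is the set of partial density operators (positive, trace $\le1$). Programs: $S::=\mathbf{skip}\mid \bar q:=|0\rangle\mid \bar q\mathrel{*{=}}U\mid \mathbf{assert}\ P[\bar q]\mid S_0;S_1\mid \mathbf{if}\ P[\bar q]\ \mathbf{then}\ S_1\ \mathbf{else}\ S_0\ \mathbf{end}\mid\mathbf{while}\ P[\bar q]\ \mathbf{do}\ S\ \mathbf{end}$, with $\bar q=q_1,\dots,q_t$ distinct variables, $U$ unitary on $\mathcal H_{\bar q}$, $P$ a subspace of $\mathcal H_{\bar q}$; the first four forms are the basic commands.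 Semantics $\llbracket S\rrbracket:\mathcal D(\mathcal H_V)\to\mathcal D(\mathcal H_V)$: $\llbracket\mathbf{skip}\rrbracket(\rho)=\rho$; $\llbracket\bar q:=|0\rangle\rrbracket(\rho)=\sum_{i=0}^{2^t-1}|0\rangle_{\bar q}\langle i|\rho|i\rangle_{\bar q}\langle0|$; $\llbracket\bar q\mathrel{*{=}}U\rrbracket(\rho)=U\rho U^\dagger$; $\llbracket\mathbf{assert}\ P[\bar q]\rrbracket(\rho)=P\rho P$; $\llbracket S_0;S_1\rrbracket=\llbracket S_1\rrbracket\circ\llbracket S_0\rrbracket$; $\llbracket\mathbf{if}\ P[\bar q]\ \mathbf{then}\ S_1\ \mathbf{else}\ S_0\ \mathbf{end}\rrbracket(\rho)=\llbracket\mathbf{assert}\ P[\bar q];S_1\rrbracket(\rho)+\llbracket\mathbf{assert}\ P^\perp[\bar q];S_0\rrbracket(\rho)$; $\llbracket\mathbf{while}\ P[\bar q]\ \mathbf{do}\ S\ \mathbf{end}\rrbracket(\rho)=\sum_{i\ge0}\llbracket(\mathbf{assert}\ P[\bar q];S)^i;\mathbf{assert}\ P^\perp[\bar q]\rrbracket(\rho)$, where $T^i$ is $i$-fold sequential composition ($T^0=\mathbf{skip}$). The concrete domain is $\mathcal Q=2^{\mathcal D(\mathcal H_V)}$ ordered by inclusion, and $\llbracket S\rrbracket(R)=\{\llbracket S\rrbracket(\rho):\rho\in R\}$. A complete lattice $(\mathcal A,\le_{\mathcal A},\vee,\wedge,\bot,\top)$ together with a satisfaction relation $\models\subseteq\mathcal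 D(\mathcal H_V)\times\mathcal A$ such that $a\le_{\mathcal A}a'$ iff every $\rho\models a$ satisfies $\rho\models a'$, is a well-structured set of quantum assertions if (1) whenever $\rho\models a$ for all $a$ in a subset $A\subseteq\mathcal A$, then $\rho\models\bigwedge A$; and (2) for any $a\in\mathcal A$, $\rho_i\in\mathcal D(\mathcal H_V)$, reals $x_i>0$ with $\sum_i x_i\rho_i\in\mathcal D(\mathcal H_V)$: $\sum_i x_i\rho_i\models a$ iff $\rho_i\models a$ for all $i$. $\mathrm{PS}$ is a proof system deriving triples $\{a\}S\{a'\}$ ($a,a'\in\mathcal A$) consisting of an axiom schema for each basic command, one proof rule for each composite construct (sequential composition, conditional, loop), and the consequence rule: from $a\le_{\mathcal A}a'$, $\{a'\}S\{b'\}$, $b'\le_{\mathcal A}b$ infer $\{a\}S\{b\}$; the rule for sequential composition is: from $\{a\}S_0\{a'\}$ and $\{a'\}S_1\{b\}$ infer $\{a\}S_0;S_1\{b\}$. Write $\vdash_{\mathrm{PS}}$ for derivability. Validity: $\models_{\mathrm{PS}}\{a\}S\{a'\}$ iff $\rho\models a$ implies $\llbracket S\rrbracket(\rho)\models a'$ for all $\rho\in\mathcal D(\mathcal H_V)$. $\mathrm{PS}$ is sound if derivable implies valid, relatively complete if valid implies derivable. The induced abstract interpretation: $\gamma(a)=\{\rho:\rho\models a\}$, $\alpha(R)=\bigwedge\{b\in\mathcal A:R\subseteq\gamma(b)\}$ (for $R\in\mathcal Q$), and $\llbracket S\rrbracket^\#(a)=\bigwedge\{a'\in\mathcal A:\vdash_{\mathrm{PS}}\{a\}S\{a'\}\}$.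 An operator $f^\#:\mathcal A\to\mathcal A$ is a sound abstraction of $f:\mathcal Q\to\mathcal Q$ if $\alpha(f(R))\le_{\mathcal A}f^\#(\alpha(R))$ for all $R$, and complete if equality holds for all $R$. *)

(* Defs.v *)
From mathcomp Require Import all_boot all_order all_algebra.
From mathcomp Require Import all_classical all_reals all_analysis.
From mathcomp Require Import complex.
Set Implicit Arguments.
Unset Strict Implicit.
Unset Printing Implicit Defensive.
Import GRing.Theory Num.Theory numFieldNormedType.Exports.
Local Open Scope ring_scope.

(* The set V of quantum variables is 'I_n (n qubits).  The computational      *)
(* basis of H_W for |W| = t is indexed by bitstrings  bits t := 'I_t -> bool, *)
(* and operators on H_W are matrices indexed by 'I_(dim t), dim t = #|bits t| *)
(* (= 2^t), via enum_rank / enum_val.                                          *)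

Section Quantum.
Variables (R : realType) (n : nat).
Local Notation C := (R[i]).

Definition bits (t : nat) := {ffun 'I_t -> bool}.
Definition dim (t : nat) := #|{: bits t}|.

Definition mx := 'M[C]_(dim n).

Definition adj {m p : nat} (M : 'M[C]_(m, p)) : 'M[C]_(p, m) := (map_mx (@conjc R) M)^T.

Definition psd (M : mx) : Prop :=
  forall v : 'cV[C]_(dim n), 0 <= (adj v *m M *m v) 0 0.
Definition pdo (M : mx) : Prop := psd M /\ \tr M <= 1.

Definition unitary {t : nat} (U : 'M[C]_(dim t)) : Prop :=
  adj U *m U = 1%:M /\ U *m adj U = 1%:M.
(* a subspace is identified with its orthogonal projector *)
Definition projector {t : nat} (P : 'M[C]_(dim t)) : Prop :=
  P *m P = P /\ adj P = P.
Definition ocompl {t : nat} (P : 'M[C]_(dim t)) : 'M[C]_(dim t) := 1%:M - P.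

Definition restrict {t : nat} (qs : t.-tuple 'I_n) (x : bits n) : bits t :=
  [ffun k => x (tnth qs k)].

(* cylindrical extension of an operator on H_qs to H_V (i.e. M (x) I) *)
Definition cyl {t : nat} (qs : t.-tuple 'I_n) (M : 'M[C]_(dim t)) : mx :=
  \matrix_(i, j)
    let x : bits n := enum_val i in let y : bits n := enum_val j in
    if [forall q : 'I_n, (q \notin qs) ==> (x q == y q)]
    then M (enum_rank (restrict qs x)) (enum_rank (restrict qs y))
    else 0.

Definition ketbra {t : nat} (x y : bits t) : 'M[C]_(dim t) :=
  \matrix_(i, j) (((enum_val i : bits t) == x) && ((enum_val j : bits t) == y))%:R.
Definition zero_bits (t : nat) : bits t := [ffun _ => false].

Definition mlim (u : nat -> mx) : mx :=
  \matrix_(i, j) ((limn (fun k => complex.Re (u k i j)))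
                  +i* (limn (fun k => complex.Im (u k i j))))%C.

Inductive prog : Type :=
| Skip
| Init (t : nat) (qs : t.-tuple 'I_n)
| Unit (t : nat) (qs : t.-tuple 'I_n) (U : 'M[C]_(dim t))
| Assert (t : nat) (qs : t.-tuple 'I_n) (P : 'M[C]_(dim t))
| Seq (S0 S1 : prog)
| Cond (t : nat) (qs : t.-tuple 'I_n) (P : 'M[C]_(dim t)) (S1 S0 : prog)
| While (t : nat) (qs : t.-tuple 'I_n) (P : 'M[C]_(dim t)) (c : prog).

Definition is_basic (c : prog) : bool :=
  match c with Skip | Init _ _ | Unit _ _ _ | Assert _ _ _ => true | _ => false end.

Fixpoint wf (c : prog) : Prop :=
  match c with
  | Skip => True
  | Init t qs => uniq qs
  | Unit t qs U => uniq qs /\ unitary U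
  | Assert t qs P => uniq qs /\ projector P
  | Seq S0 S1 => wf S0 /\ wf S1
  | Cond t qs P S1 S0 => [/\ uniq qs, projector P, wf S1 & wf S0]
  | While t qs P c => [/\ uniq qs, projector P & wf c]
  end.

Fixpoint sem (c : prog) (rho : mx) : mx :=
  match c with
  | Skip => rho
  | Init t qs =>
      \sum_(x : bits t)
        cyl qs (ketbra (zero_bits t) x) *m rho *m adj (cyl qs (ketbra (zero_bits t) x))
  | Unit t qs U => cyl qs U *m rho *m adj (cyl qs U)
  | Assert t qs P => cyl qs P *m rho *m cyl qs P
  | Seq S0 S1 => sem S1 (sem S0 rho)
  | Cond t qs P S1 S0 =>
      sem S1 (cyl qs P *m rho *m cyl qs P)
      + sem S0 (cyl qs (ocompl P) *m rho *m cyl qs (ocompl P))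
  | While t qs P c =>
      mlim (fun k => \sum_(i < k)
        (cyl qs (ocompl P) *m
           iter i (fun r => sem c (cyl qs P *m r *m cyl qs P)) rho
         *m cyl qs (ocompl P)))
  end.

Section Assertions.
Variables (A : Type) (le : A -> A -> Prop) (meet : (A -> Prop) -> A)
          (sat : mx -> A -> Prop).

Definition complete_lattice : Prop :=
  [/\ (forall a, le a a),
      (forall a b c, le a b -> le b c -> le a c),
      (forall a b, le a b -> le b a -> a = b),
      (forall (X : A -> Prop) a, X a -> le (meet X) a) &
      (forall (X : A -> Prop) b, (forall a, X a -> le b a) -> le b (meet X))].

Definition well_structured : Prop :=
  [/\ complete_lattice,
      (forall a a', le a a' <-> (forall rho, pdo rho -> sat rho a -> sat rho a')),
      (forall rho (X : A -> Prop), pdo rho -> (forall a, X a -> sat rho a) ->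
         sat rho (meet X)) &
      (forall a (k : nat) (x : 'I_k -> R) (rhos : 'I_k -> mx),
         (forall i, 0 < x i) -> (forall i, pdo (rhos i)) ->
         pdo (\sum_(i < k) (x i)%:C%C *: rhos i) ->
         (sat (\sum_(i < k) (x i)%:C%C *: rhos i) a <-> (forall i, sat (rhos i) a)))].

(* A proof system PS: an axiom schema for basic commands (ax), one rule for
   the conditional (rif: premises {a1}S1{b1}, {a0}S0{b0}, conclusion {a}if..{b}),
   one rule for the loop (rwh: premise {a1}c{b1}, conclusion {a}while..{b}),
   the sequential-composition rule and the consequence rule. *)
Variables (ax : prog -> A -> A -> Prop)
          (rif : prog -> A -> A -> A -> A -> A -> A -> Prop)
          (rwh : prog -> A -> A -> A -> A -> Prop).

Inductive derivable : A -> prog -> A -> Prop :=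
| d_ax c a b : is_basic c -> ax c a b -> derivable a c b
| d_seq a a' b S0 S1 :
    derivable a S0 a' -> derivable a' S1 b -> derivable a (Seq S0 S1) b
| d_if (t : nat) (qs : t.-tuple 'I_n) P S1 S0 a1 b1 a0 b0 a b :
    derivable a1 S1 b1 -> derivable a0 S0 b0 ->
    rif (Cond qs P S1 S0) a1 b1 a0 b0 a b -> derivable a (Cond qs P S1 S0) b
| d_while (t : nat) (qs : t.-tuple 'I_n) P c a1 b1 a b :
    derivable a1 c b1 -> rwh (While qs P c) a1 b1 a b ->
    derivable a (While qs P c) b
| d_cons a a' b' b c :
    le a a' -> derivable a' c b' -> le b' b -> derivable a c b.

Definition valid (a : A) (c : prog) (b : A) : Prop :=
  forall rho, pdo rho -> sat rho a -> sat (sem c rho) b.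

Definition PS_sound : Prop :=
  forall a c b, wf c -> derivable a c b -> valid a c b.
Definition PS_rel_complete : Prop :=
  forall a c b, wf c -> valid a c b -> derivable a c b.

Definition in_Q (X : mx -> Prop) : Prop := forall rho, X rho -> pdo rho.
Definition gamma (a : A) : mx -> Prop := fun rho => pdo rho /\ sat rho a.
Definition alpha (X : mx -> Prop) : A :=
  meet (fun b => forall rho, X rho -> gamma b rho).
Definition sem_set (c : prog) (X : mx -> Prop) : mx -> Prop :=
  fun sigma => exists2 rho, X rho & sigma = sem c rho.
Definition abs_sem (c : prog) (a : A) : A :=
  meet (fun a' => derivable a c a').

Definition sound_abstraction (f : (mx -> Prop) -> (mx -> Prop)) (fs : A -> A) : Prop :=
  forall X, in_Q X -> le (alpha (f X)) (fs (alpha X)).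
Definition complete_abstraction (f : (mx -> Prop) -> (mx -> Prop)) (fs : A -> A) : Prop :=
  forall X, in_Q X -> alpha (f X) = fs (alpha X).

End Assertions.
End Quantum.

(* Main.v *)
(* Every program denotes a map that preserves positive semidefinite matrices,
   does not increase the trace, and is additive and positively homogeneous; for
   loops this passes through the limit because the entries of a positive
   semidefinite matrix are bounded by its trace. Part (1) then follows by
   applying soundness to each derivable triple.

   For part (2), states satisfying [alpha X] need not lie in [X], so given [b]
   with [sem c X |= b] it must be shown that [alpha X] entails the weakest
   precondition of [b]. That precondition W is closed under sums and under
   passing to summands, hence consists of the states supported on a subspace P,
   the support of an element of W of maximal rank. The triple
   {top} assert P; c {b} is valid, hence derivable, and the sequential rule
   supplies an intermediate assertion whose models are exactly W. *)
Require Import Defs.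
From mathcomp Require Import all_boot all_order all_algebra.
From mathcomp Require Import all_classical all_reals all_analysis.
From mathcomp Require Import complex spectral.
From mathcomp Require Import ring lra.

Set Implicit Arguments.
Unset Strict Implicit.
Unset Printing Implicit Defensive.
Import Order.TTheory GRing.Theory Num.Theory numFieldNormedType.Exports.
Import Defs.
Local Open Scope ring_scope.

(** * Adjoints of complex matrices *)

Section Adjoint.
Variable R : realType.
Local Notation C := R[i].

Lemma adjE m p (M : 'M[C]_(m, p)) i j : adj M i j = conjc (M j i).
Proof. by rewrite /adj !mxE. Qed.

Lemma adjK m p (M : 'M[C]_(m, p)) : adj (adj M) = M.
Proof. by apply/matrixP => i j; rewrite !adjE conjcK. Qed.

Lemma adjM m p q (M : 'M[C]_(m, p)) (N : 'M[C]_(p, q)) :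
  adj (M *m N) = adj N *m adj M.
Proof. by rewrite /adj map_mxM trmx_mul. Qed.

Lemma adjD m p (M N : 'M[C]_(m, p)) : adj (M + N) = adj M + adj N.
Proof. by rewrite /adj map_mxD linearD. Qed.

Lemma adjB m p (M N : 'M[C]_(m, p)) : adj (M - N) = adj M - adj N.
Proof. by rewrite /adj map_mxB linearB. Qed.

Lemma adj_id m : adj (1%:M : 'M[C]_m) = 1%:M.
Proof. by rewrite /adj map_mx1 trmx1. Qed.

Lemma adj_diag m (d : 'rV[C]_m) : (forall i, 0 <= d 0 i) -> adj (diag_mx d) = diag_mx d.
Proof.
move=> d0; apply/matrixP => i j; rewrite adjE !mxE eq_sym.
case: eqP => [->|_]; rewrite ?mulr1n ?mulr0n ?rmorph0 //.
move: (d0 j); case: (d 0 j) => a b; rewrite lecE /= => /andP[/eqP -> _].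
by rewrite oppr0.
Qed.

Lemma qf_diag m (d : 'rV[C]_m) (v : 'cV[C]_m) :
  (adj v *m diag_mx d *m v) 0 0 = \sum_i d 0 i * `|v i 0| ^+ 2.
Proof.
rewrite mxE; apply: eq_bigr => i _.
by rewrite mul_mx_diag mxE adjE sqr_normc mulrAC mulrC [X in _ * X]mulrC.
Qed.

End Adjoint.

(** * Positive semidefinite matrices: entries, spectrum, support *)

Section Psd.
Variables (R : realType) (n : nat).
Local Notation C := R[i].
Implicit Types M N : mx R n.

Lemma psd0 : psd (0 : mx R n).
Proof. by move=> v; rewrite mulmx0 mul0mx mxE. Qed.

Lemma psdD M N : psd M -> psd N -> psd (M + N).
Proof. by move=> hM hN v; rewrite mulmxDr mulmxDl mxE addr_ge0 ?hM ?hN. Qed.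

Lemma psdZ (a : C) M : 0 <= a -> psd M -> psd (a *: M).
Proof. by move=> a0 hM v; rewrite -scalemxAr -scalemxAl mxE mulr_ge0 ?hM. Qed.

Lemma psd_sum (I : Type) (r : seq I) (F : I -> mx R n) :
  (forall i, psd (F i)) -> psd (\sum_(i <- r) F i).
Proof.
by move=> hF; apply: big_ind => [|M N hM hN|i _]; [exact: psd0 | exact: psdD | exact: hF].
Qed.

Lemma psd_conj (K : mx R n) M : psd M -> psd (K *m M *m adj K).
Proof.
by move=> hM v; have := hM (adj K *m v); rewrite adjM adjK !mulmxA.
Qed.

Lemma psd_diag_mx (d : 'rV[C]_(dim n)) :
  (forall i, 0 <= d 0 i) -> psd (diag_mx d : mx R n).
Proof.
by move=> d0 v; rewrite qf_diag sumr_ge0 // => i _; rewrite mulr_ge0 ?exprn_ge0.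
Qed.

Definition test_vec (i j : 'I_(dim n)) (c : C) : 'cV[C]_(dim n) :=
  delta_mx i 0 + c *: delta_mx j 0.

Lemma qf_test_vec M i j c :
  (adj (test_vec i j c) *m M *m test_vec i j c) 0 0 =
    M i i + c * M i j + conjc c * M j i + conjc c * c * M j j.
Proof.
have dE (k : 'I_(dim n)) : adj (delta_mx k 0 : 'cV[C]__) = delta_mx 0 k.
  by apply/matrixP => a b; rewrite adjE !mxE andbC rmorph_nat.
have aE : adj (test_vec i j c) = delta_mx 0 i + conjc c *: delta_mx 0 j.
  rewrite /test_vec adjD dE; congr (_ + _); apply/matrixP => a b.
  by rewrite adjE [in LHS]mxE rmorphM [RHS]mxE -dE adjE.
have ME (k l : 'I_(dim n)) : (row k M *m (delta_mx l 0 : 'cV[C]__)) 0 0 = M k l.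
  by rewrite -colE !mxE.
rewrite aE /test_vec !(mulmxDl, mulmxDr) -!scalemxAr -!scalemxAl -!rowE.
have addE (A B : 'M[C]_1) : (A + B) 0 0 = A 0 0 + B 0 0 by rewrite mxE.
have scaleE a (A : 'M[C]_1) : (a *: A) 0 0 = a * A 0 0 by rewrite mxE.
by rewrite !(addE, scaleE, ME); ring.
Qed.

Lemma psd_qf_test_vec M i j c : psd M ->
  0 <= M i i + c * M i j + conjc c * M j i + conjc c * c * M j j.
Proof. by move=> /(_ (test_vec i j c)); rewrite qf_test_vec. Qed.

Lemma psd_diag_ge0 M i : psd M -> 0 <= M i i.
Proof.
by move=> /(psd_qf_test_vec i i 0); rewrite conjc0 !mul0r !addr0.
Qed.

Lemma psd_tr_ge0 M : psd M -> 0 <= \tr M.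
Proof. by move=> hM; apply: sumr_ge0 => i _; exact: psd_diag_ge0. Qed.

Lemma psd_diag_le_tr M i : psd M -> M i i <= \tr M.
Proof.
move=> hM; rewrite /mxtrace (bigD1 i) //= lerDl.
by apply: sumr_ge0 => j _; exact: psd_diag_ge0.
Qed.

(* Polarization: the quadratic form is real at [e_i + e_j] and [e_i + 'i e_j]. *)
Lemma psd_adj M : psd M -> adj M = M.
Proof.
move=> hM; apply/matrixP => i j; rewrite adjE.
have := psd_qf_test_vec i j 1 hM; have := psd_qf_test_vec i j 'i%C hM.
have := psd_diag_ge0 i hM; have := psd_diag_ge0 j hM.
case: (M i i) => a a'; case: (M j j) => b b'; case: (M i j) => x x'.
case: (M j i) => y y'; rewrite !lecE /=.
move=> /andP[/eqP -> _] /andP[/eqP -> _] /andP[/eqP e1 _] /andP[/eqP e2 _].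
by congr (_ +i* _)%C; lra.
Qed.

(** The form at [e_i + c e_j] for [c] among 1, -1, i, -i bounds twice the real and imaginary parts
    of [M i j] by [M i i + M j j], and a diagonal entry is at most the trace. This domination makes
    loop series converge entrywise. *)
Lemma psd_Re_Im_le M i j : psd M ->
  `|complex.Re (M i j)| <= complex.Re (\tr M) /\ `|complex.Im (M i j)| <= complex.Re (\tr M).
Proof.
move=> hM; have := psd_diag_le_tr i hM; have := psd_diag_le_tr j hM.
have := psd_qf_test_vec i j 1 hM; have := psd_qf_test_vec i j 'i%C hM.
have := psd_qf_test_vec i j (-1) hM; have := psd_qf_test_vec i j (- 'i%C) hM.
have : M j i = conjc (M i j) by rewrite -adjE psd_adj.
move=> ->; have := psd_diag_ge0 i hM; have := psd_diag_ge0 j hM.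
case: (\tr M) => t t'.
case: (M i i) => a a'; case: (M j j) => b b'; case: (M i j) => x x'.
rewrite !lecE /=.
move=> /andP[_ h1] /andP[_ h2] /andP[_ h3] /andP[_ h4] /andP[_ h5] /andP[_ h6].
move=> /andP[_ h7] /andP[_ h8].
by split; rewrite ler_norml; apply/andP; split; lra.
Qed.

(** A psd matrix is Hermitian, hence normal, so the spectral theorem applies; each eigenvalue is a
    diagonal entry of the psd matrix [U *m M *m adj U]. *)
Lemma psd_spectral M : psd M -> exists (U : mx R n) (d : 'rV[C]_(dim n)),
  [/\ adj U *m U = 1%:M, U *m adj U = 1%:M, forall i, 0 <= d 0 i &
      M = adj U *m diag_mx d *m U].
Proof.
move=> hM; pose U : mx R n := spectralmx M; pose d := spectral_diag M.
have aE (A : mx R n) : (map_mx Num.conj A^T) = adj A.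
  by apply/matrixP => i j; rewrite adjE !mxE.
have UU : U *m adj U = 1%:M.
  by have /unitarymxP := spectral_unitarymx M; rewrite aE.
have UU' : adj U *m U = 1%:M by exact: mulmx1C.
have ME : M = adj U *m diag_mx d *m U.
  have /orthomx_spectralP : M \is normalmx.
    by apply/normalmxP; rewrite aE psd_adj.
  have := invmx_unitary (spectral_unitarymx M).
  by rewrite (aE U) -/U -/d => ->.
exists U, d; split => // i.
have := psd_diag_ge0 i (psd_conj U hM).
rewrite {1}ME !mulmxA UU mul1mx -mulmxA UU mulmx1 mxE eqxx mulr1n; exact.
Qed.

(** In the eigenbasis the form is a sum of nonnegative terms [d_i |(U v)_i|^2], so if it vanishes
    then every [d_i (U v)_i] does. *)
Lemma psd_qf_eq0 M (v : 'cV[C]_(dim n)) :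
  psd M -> (adj v *m M *m v) 0 0 = 0 -> M *m v = 0.
Proof.
move=> /psd_spectral[U [d [UU UU' d0 ->]]].
rewrite !mulmxA -[adj v *m adj U]adjM -[_ *m U *m v]mulmxA qf_diag => /eqP.
rewrite psumr_eq0 => [/allP h|i _]; last by rewrite mulr_ge0 ?exprn_ge0.
rewrite -!mulmxA; suff -> : diag_mx d *m (U *m v) = 0 by rewrite mulmx0.
apply/matrixP => i j.
rewrite mul_diag_mx mxE ord1 [RHS]mxE.
have := h i (mem_index_enum _); rewrite mulf_eq0 expf_eq0 normr_eq0 /=.
by case/orP => /eqP ->; rewrite ?mul0r ?mulr0.
Qed.

(** The trace is the sum of the nonnegative eigenvalues, hence dominates each of them. *)
Lemma psd_le_tr M : psd M -> psd ((\tr M)%:M - M).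
Proof.
move=> hM; have [U [d [UU UU' d0 ME]]] := psd_spectral hM.
have tE : \tr M = \sum_i d 0 i.
  by rewrite ME -mulmxA mxtrace_mulC -mulmxA UU' mulmx1 mxtrace_diag.
have -> : (\tr M)%:M - M = adj U *m diag_mx (const_mx (\tr M) - d) *m adj (adj U).
  rewrite adjK linearB /= mulmxBr mulmxBl -ME diag_const_mx.
  by rewrite mul_mx_scalar -scalemxAl UU scalemx1.
apply/psd_conj/psd_diag_mx => i; rewrite !mxE subr_ge0 tE (bigD1 i) //= lerDl.
exact: sumr_ge0.
Qed.

(** [P] is the spectral projector onto the nonzero eigenvalues and [x] a positive lower bound for
    them. Kernels act on row vectors: [kermx M *m N = 0] says that the kernel of [M] lies in that of
    [N]. *)
Lemma support_projector M : psd M -> exists (P : mx R n) (x : R),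
  [/\ projector P, 0 < x, psd (M - x%:C%C *: P) &
      forall N, psd N -> kermx M *m N = 0 -> P *m N = N].
Proof.
move=> hM; have [U [d [UU UU' d0 ME]]] := psd_spectral hM.
pose e : 'rV[C]_(dim n) := \row_i (d 0 i != 0)%:R.
have e0 i : 0 <= e 0 i by rewrite mxE ler0n.
(* The inverse of [l] exceeds the inverse of each nonzero eigenvalue, so [l] lies below them all;
   the summand 1 keeps [l] positive when [M = 0] and the sum is empty. *)
pose l : C := (1 + \sum_(i | d 0 i != 0) (d 0 i)^-1)^-1.
have s0 : 0 <= \sum_(i | d 0 i != 0) (d 0 i)^-1.
  by apply: sumr_ge0 => i _; rewrite invr_ge0.
have l0 : 0 < l by rewrite invr_gt0 ltr_pwDl.
have lE : ((complex.Re l)%:C)%C = l by apply: RRe_real; rewrite ger0_real ?ltW.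
have le_l i : l * e 0 i <= d 0 i.
  rewrite mxE; have [->|di] := eqVneq (d 0 i) 0; first by rewrite mulr0.
  have dp : 0 < d 0 i by rewrite lt0r di d0.
  rewrite mulr1 -[leRHS]invrK lef_pV2 ?posrE ?invr_gt0 ?ltr_pwDl //.
  rewrite (bigD1 i) //= addrCA lerDl addr_ge0 // sumr_ge0 // => j _.
  by rewrite invr_ge0.
pose P : mx R n := adj U *m diag_mx e *m U.
have PM : P *m M = M.
  rewrite /P {1}ME !mulmxA -[_ *m U *m adj U]mulmxA UU' mulmx1.
  rewrite -[adj U *m _ *m diag_mx d]mulmxA mulmx_diag [RHS]ME; congr (_ *m _ *m _).
  congr diag_mx; apply/rowP => i; rewrite !mxE.
  by have [->|] := eqVneq (d 0 i) 0; rewrite ?mulr0 ?mul1r.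
exists P, (complex.Re l); split.
- split; last by rewrite /P !adjM adjK adj_diag // mulmxA.
  rewrite /P !mulmxA -[_ *m U *m adj U]mulmxA UU' mulmx1.
  rewrite -[adj U *m _ *m diag_mx e]mulmxA mulmx_diag; congr (_ *m _ *m _).
  congr diag_mx; apply/rowP => i; rewrite !mxE.
  by case: eqP; rewrite ?mulr0 ?mul1r.
- by rewrite -ltcR lE.
- have -> : M - ((complex.Re l)%:C)%C *: P = adj U *m diag_mx (d - l *: e) *m adj (adj U).
    have -> : diag_mx (d - l *: e) = diag_mx d - l *: diag_mx e.
      by rewrite [LHS]linearB [in LHS]linearZ.
    by rewrite lE adjK mulmxBr mulmxBl -ME -scalemxAr -scalemxAl.
  by apply/psd_conj/psd_diag_mx => i; rewrite mxE [X in _ + X]mxE [X in _ - X]mxE subr_ge0.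
- move=> N hN kN; apply/eqP; rewrite -subr_eq0 -opprB oppr_eq0 -{1}[N]mul1mx -mulmxBl.
  (* [P *m M = M] puts the rows of [1 - P] in the left kernel of [M], which annihilates [N]. *)
  have /submxP[D ->] : (1%:M - P <= kermx M)%MS.
    by rewrite sub_kermx mulmxBl mul1mx PM subrr.
  by rewrite -mulmxA kN mulmx0.
Qed.

(** If [v (M + N) = 0], the nonnegative numbers [v M v*] and [v N v*] add up to 0, so both vanish,
    and a vanishing form forces [v M = 0]. *)
Lemma kermx_psdD M N : psd M -> psd N -> (kermx (M + N) <= kermx M)%MS.
Proof.
move=> hM hN; apply/rV_subP => v /sub_kermxP vMN; apply/sub_kermxP.
have q0 : (v *m M *m adj v) 0 0 + (v *m N *m adj v) 0 0 = 0.
  have /matrixP/(_ 0 0) : v *m (M + N) *m adj v = 0 by rewrite vMN mul0mx.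
  by rewrite mulmxDr mulmxDl !mxE.
have q1 : 0 <= (v *m M *m adj v) 0 0 by have := hM (adj v); rewrite adjK.
have q2 : 0 <= (v *m N *m adj v) 0 0 by have := hN (adj v); rewrite adjK.
move: q0 => /eqP; rewrite paddr_eq0 // => /andP[/eqP q0 _].
have := @psd_qf_eq0 M (adj v) hM; rewrite adjK => /(_ q0).
move=> /(congr1 (@adj R _ _)); rewrite adjM adjK psd_adj // => ->.
by apply/matrixP => i j; rewrite adjE !mxE conjc0.
Qed.

(** Take [M] of maximal rank in [W]. The kernel of [M + N] lies in that of [M] and, by maximality,
    is no smaller, so [N] vanishes on it. The scalar [a] leaves the rank unchanged and allows for
    sets that bound the trace. *)
Lemma max_rank_kermx (W : mx R n -> Prop) :
  (exists M, W M) -> (forall M, W M -> psd M) ->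
  (forall M N, W M -> W N -> exists2 a : C, a != 0 & W (a *: (M + N))) ->
  exists2 M, W M & forall N, W N -> kermx M *m N = 0.
Proof.
move=> [M0 W0] Wpsd Wadd.
pose p k := `[< exists2 M, W M & \rank M = k >].
have ex_p : exists k, p k by exists (\rank M0); apply/asboolP; exists M0.
have p_le k : p k -> (k <= dim n)%N.
  by move=> /asboolP[M _ <-]; exact: rank_leq_row.
have [k /asboolP[M WM rM] kmax] := ex_maxnP ex_p p_le.
exists M => // N WN; have [a a0 WMN] := Wadd _ _ WM WN.
have kle : (kermx (M + N) <= kermx M)%MS by apply: kermx_psdD; exact: Wpsd.
have : (\rank (a *: (M + N)) <= k)%N.
  by apply: kmax; apply/asboolP; exists (a *: (M + N)).
rewrite (eqmx_scale _ a0) -rM => rle.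
have /sub_kermxP : (kermx M <= kermx (M + N))%MS.
  by rewrite -(geq_leqif (mxrank_leqif_sup kle)) !mxrank_ker leq_sub2l.
by rewrite mulmxDr mulmx_ker add0r.
Qed.

End Psd.

(** * Cylindrical extension as a unital homomorphism compatible with adjoints *)

Section Cyl.
Variables (R : realType) (n t : nat) (qs : t.-tuple 'I_n).
Local Notation C := R[i].
Implicit Types (x y z : bits n) (b : bits t) (M N : 'M[C]_(dim t)).

Definition agree_off x y := [forall q : 'I_n, (q \notin qs) ==> (x q == y q)].

(** [insub] yields the position of [q] in [qs], if any; otherwise the bit of [x] is kept. For
    distinct variables, [overwrite x] thus parametrizes by [bits t] the bitstrings agreeing with [x]
    off [qs]. *)
Definition overwrite x b : bits n :=
  [ffun q => oapp b (x q) (insub (index q qs))].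

Lemma agree_offP x y :
  reflect (forall q, q \notin qs -> x q = y q) (agree_off x y).
Proof.
apply: (iffP forallP) => [h q qN|h q]; last by apply/implyP => /h ->.
by have := h q; rewrite qN => /eqP.
Qed.

Lemma agree_off_sym x y : agree_off x y = agree_off y x.
Proof. by apply/agree_offP/agree_offP => h q /h. Qed.

Lemma agree_off_trans y x z : agree_off x y -> agree_off y z -> agree_off x z.
Proof.
by move=> /agree_offP xy /agree_offP yz; apply/agree_offP => q qN; rewrite xy ?yz.
Qed.

Lemma agree_off_overwrite x b : agree_off x (overwrite x b).
Proof.
apply/agree_offP => q; rewrite -index_mem size_tuple -leqNgt => h.
by rewrite ffunE insubF // ltnNge h.
Qed.

Lemma overwrite_restrict x y : agree_off x y -> overwrite x (restrict qs y) = y.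
Proof.
move=> /agree_offP xy; apply/ffunP => q; rewrite ffunE.
case: insubP => [k kt kq|] /=.
  by rewrite ffunE (tnth_nth q) kq nth_index // -index_mem size_tuple.
by rewrite -[X in (_ < X)%N](size_tuple qs) index_mem => /xy.
Qed.

Lemma restrict_overwrite x b : uniq qs -> restrict qs (overwrite x b) = b.
Proof.
move=> Uqs; apply/ffunP => k; rewrite !ffunE (tnth_nth (tnth qs k)).
by rewrite index_uniq ?size_tuple // valK.
Qed.

Lemma cylE M x y : cyl qs M (enum_rank x) (enum_rank y) =
  if agree_off x y then M (enum_rank (restrict qs x)) (enum_rank (restrict qs y)) else 0.
Proof. by rewrite mxE !enum_rankK. Qed.

Lemma mx_bitsP k (M N : 'M[C]_(dim k)) :
  (forall x y : bits k, M (enum_rank x) (enum_rank y) = N (enum_rank x) (enum_rank y)) ->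
  M = N.
Proof.
move=> MN; apply/matrixP => i j.
by have := MN (enum_val i) (enum_val j); rewrite !enum_valK.
Qed.

Lemma sum_bits k (F : 'I_(dim k) -> C) : \sum_i F i = \sum_(x : bits k) F (enum_rank x).
Proof.
rewrite (reindex (@enum_rank _)) //=; exists enum_val => ? _.
  by rewrite enum_rankK.
by rewrite enum_valK.
Qed.

Lemma adj_cyl M : adj (cyl qs M) = cyl qs (adj M).
Proof.
apply: mx_bitsP => x y; rewrite adjE !cylE agree_off_sym.
by case: ifP; rewrite ?conjc0 // adjE.
Qed.

Lemma cylD M N : cyl qs (M + N) = cyl qs M + cyl qs N.
Proof.
apply: mx_bitsP => x y; rewrite [RHS]mxE !cylE.
by case: ifP; rewrite ?addr0 // mxE.
Qed.

Lemma cyl0 : cyl qs (0 : 'M[C]_(dim t)) = 0.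
Proof. by apply: mx_bitsP => x y; rewrite cylE !mxE if_same. Qed.

Hypothesis Uqs : uniq qs.

Lemma cyl1 : cyl qs (1%:M : 'M[C]_(dim t)) = 1%:M.
Proof.
apply: mx_bitsP => x y; rewrite cylE !mxE !(inj_eq enum_rank_inj).
case: ifP => [xy|]; last by case: (eqVneq x y) => // ->; move/agree_offP; case.
congr (_%:R); congr nat_of_bool; apply/eqP/eqP => [e|-> //].
by rewrite -(overwrite_restrict xy) -e overwrite_restrict //; apply/agree_offP.
Qed.

(** Only those [y] that agree off [qs] with both [x] and [z] contribute to the entry of the product.
    If [x] and [z] disagree there are none; otherwise [overwrite x] reindexes them by [bits t]. *)
Lemma cylM M N : cyl qs (M *m N) = cyl qs M *m cyl qs N.
Proof.
apply: mx_bitsP => x z; rewrite cylE !mxE !sum_bits.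
rewrite (eq_bigr (fun y => if agree_off x y && agree_off y z then
   M (enum_rank (restrict qs x)) (enum_rank (restrict qs y)) *
   N (enum_rank (restrict qs y)) (enum_rank (restrict qs z)) else 0)); last first.
  move=> y _; rewrite !cylE.
  by case: agree_off => //=; rewrite ?mul0r //; case: agree_off; rewrite ?mulr0.
rewrite -big_mkcond /=; case: ifPn => [xz|xz]; last first.
  rewrite big1 // => y /andP[xy yz].
  by rewrite (agree_off_trans xy yz) in xz.
rewrite (eq_bigl (agree_off x)) => [|y]; last first.
  apply: andb_idr => xy; apply: agree_off_trans xz.
  by rewrite agree_off_sym.
rewrite [RHS](reindex_onto (overwrite x) (restrict qs)); last first.
  by move=> y; exact: overwrite_restrict.
apply: eq_big => [b|b _]; last by rewrite restrict_overwrite.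
by rewrite agree_off_overwrite restrict_overwrite // eqxx.
Qed.

End Cyl.

(** * Matrix units *)

Section Ketbra.
Variables (R : realType) (t : nat).
Local Notation C := R[i].
Implicit Types x y z : bits t.

Lemma ketbraE x y x' y' :
  ketbra R x y (enum_rank x') (enum_rank y') = ((x' == x) && (y' == y))%:R.
Proof. by rewrite mxE !enum_rankK. Qed.

Lemma adj_ketbra x y : adj (ketbra R x y) = ketbra R y x.
Proof.
by apply: mx_bitsP => x' y'; rewrite adjE !ketbraE andbC rmorph_nat.
Qed.

Lemma mul_ketbra x y z : ketbra R x y *m ketbra R y z = ketbra R x z.
Proof.
apply: mx_bitsP => x' z'; rewrite mxE sum_bits (bigD1 y) //= big1 => [|w wy].
  by rewrite !ketbraE !eqxx andbT addr0 /= -natrM mulnb.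
by rewrite !ketbraE (negbTE wy) andbF mul0r.
Qed.

Lemma sum_ketbra : \sum_(x : bits t) ketbra R x x = 1%:M.
Proof.
apply: mx_bitsP => x y; rewrite summxE (bigD1 x) //= big1 => [|w wx].
  by rewrite ketbraE eqxx addr0 mxE (inj_eq enum_rank_inj) eq_sym.
by rewrite ketbraE eq_sym (negbTE wx).
Qed.

End Ketbra.

(** This lets a projector on the whole space be used in an [Assert] command. *)
Lemma cyl_ord_tuple (R : realType) n (M : 'M[R[i]]_(dim n)) : cyl (ord_tuple n) M = M.
Proof.
have rE (x : bits n) : restrict (ord_tuple n) x = x.
  by apply/ffunP => q; rewrite ffunE tnth_ord_tuple.
apply: mx_bitsP => x y; rewrite cylE !rE.
case: ifPn => // /negP[]; apply/agree_offP => q.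
by rewrite -{1}(tnth_ord_tuple q) mem_tnth.
Qed.

(** * Limits of complex sequences *)

Section Convergence.
Variable R : realType.
Local Notation C := R[i].
Local Open Scope classical_set_scope.

(* [R[i]] carries no topology here, so convergence is stated componentwise, as in [mlim]. *)
Definition ccvg (u : nat -> C) (l : C) :=
  ((fun k => complex.Re (u k)) @ \oo --> complex.Re l) /\
  ((fun k => complex.Im (u k)) @ \oo --> complex.Im l).

Lemma ccvg_cst l : ccvg (fun=> l) l.
Proof. by split; exact: cvg_cst. Qed.

Lemma ccvgD u v l m : ccvg u l -> ccvg v m -> ccvg (fun k => u k + v k) (l + m).
Proof.
move=> [ur ui] [vr vi]; split.
  have -> : complex.Re (l + m) = complex.Re l + complex.Re m by case: l {ur ui}; case: m {vr vi}.
  rewrite (_ : (fun k => _) = (fun k => complex.Re (u k)) \+ (fun k => complex.Re (v k))).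
    exact: cvgD.
  by apply/funext => k /=; case: (u k); case: (v k).
have -> : complex.Im (l + m) = complex.Im l + complex.Im m by case: l {ur ui}; case: m {vr vi}.
rewrite (_ : (fun k => _) = (fun k => complex.Im (u k)) \+ (fun k => complex.Im (v k))).
  exact: cvgD.
by apply/funext => k /=; case: (u k); case: (v k).
Qed.

Lemma ccvgMl (c : C) u l : ccvg u l -> ccvg (fun k => c * u k) (c * l).
Proof.
move=> [ur ui]; split.
  rewrite (_ : complex.Re (c * l) = complex.Re c * complex.Re l - complex.Im c * complex.Im l);
    last by case: c l {ur ui} => ? ? [].
  rewrite (_ : (fun k => _) = (fun k => complex.Re c * complex.Re (u k))
    \- (fun k => complex.Im c * complex.Im (u k))).
    by apply: cvgB; apply: cvgMr.
  by apply/funext => k /=; case: c (u k) => ? ? [].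
rewrite (_ : complex.Im (c * l) = complex.Re c * complex.Im l + complex.Im c * complex.Re l);
  last by case: c l {ur ui} => ? ? [].
rewrite (_ : (fun k => _) = (fun k => complex.Re c * complex.Im (u k))
  \+ (fun k => complex.Im c * complex.Re (u k))).
  by apply: cvgD; apply: cvgMr.
by apply/funext => k /=; case: c (u k) => ? ? [].
Qed.

Lemma ccvg_sum (I : Type) (r : seq I) (u : I -> nat -> C) (l : I -> C) :
  (forall i, ccvg (u i) (l i)) -> ccvg (fun k => \sum_(i <- r) u i k) (\sum_(i <- r) l i).
Proof.
move=> ul; elim: r => [|i r IHr].
  rewrite big_nil (_ : (fun k => _) = fun=> 0); first exact: ccvg_cst.
  by apply/funext => k; rewrite big_nil.
rewrite big_cons (_ : (fun k => _) = fun k => u i k + \sum_(j <- r) u j k).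
  exact: ccvgD.
by apply/funext => k; rewrite big_cons.
Qed.

(** Nonnegativity in [C] means zero imaginary part and nonnegative real part; both conditions are
    closed. *)
Lemma ccvg_ge0 u l : (forall k, 0 <= u k) -> ccvg u l -> 0 <= l.
Proof.
move=> u0 [ur ui]; rewrite lecE /=; apply/andP; split.
  have <- := cvg_lim (@Rhausdorff R) ui.
  rewrite (_ : (fun k => _) = fun=> 0); first by rewrite lim_cst.
  by apply/funext => k; rewrite ger0_Im.
apply: (cvgr_to_ge ur); near=> k.
by have := u0 k; rewrite lecE => /andP[].
Unshelve. all: by end_near. Qed.

Lemma ccvg_le u l m : (forall k, u k <= m) -> ccvg u l -> l <= m.
Proof.
move=> um ul; rewrite -subr_ge0 -mulN1r.
apply: (@ccvg_ge0 (fun k => m + -1 * u k)) => [k|].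
  by rewrite mulN1r subr_ge0.
by apply: ccvgD; [exact: ccvg_cst | exact: ccvgMl].
Qed.

End Convergence.

(** * Entrywise limits of matrices *)

Section MatrixConvergence.
Variables (R : realType) (n : nat).
Local Notation C := R[i].
Local Open Scope classical_set_scope.
Implicit Types (u v : nat -> mx R n) (L : mx R n).

Definition mcvg u L := forall i j, ccvg (fun k => u k i j) (L i j).

Lemma mlimE u L : mcvg u L -> mlim u = L.
Proof.
move=> uL; apply/matrixP => i j; rewrite mxE; have [ur ui] := uL i j.
have -> := cvg_lim (@Rhausdorff R) ur; have -> := cvg_lim (@Rhausdorff R) ui.
by case: (L i j).
Qed.

Lemma mcvgD u v L K : mcvg u L -> mcvg v K -> mcvg (fun k => u k + v k) (L + K).
Proof.
move=> uL vK i j; rewrite mxE.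
rewrite (_ : (fun k => _) = fun k => u k i j + v k i j); first exact: ccvgD.
by apply/funext => k; rewrite mxE.
Qed.

Lemma mcvgZ (a : C) u L : mcvg u L -> mcvg (fun k => a *: u k) (a *: L).
Proof.
move=> uL i j; rewrite mxE.
rewrite (_ : (fun k => _) = fun k => a * u k i j); first exact: ccvgMl.
by apply/funext => k; rewrite mxE.
Qed.

Lemma mcvg_psd u L : (forall k, psd (u k)) -> mcvg u L -> psd L.
Proof.
move=> upsd uL w.
have qE (M : mx R n) :
    (adj w *m M *m w) 0 0 = \sum_j \sum_i adj w 0 i * w j 0 * M i j.
  rewrite mxE; apply: eq_bigr => j _; rewrite mxE mulr_suml.
  by apply: eq_bigr => i _; rewrite mulrAC.
apply: (@ccvg_ge0 _ (fun k => (adj w *m u k *m w) 0 0)) => [k|]; first exact: upsd.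
rewrite qE (_ : (fun k => _) = fun k => \sum_j \sum_i adj w 0 i * w j 0 * u k i j).
  by do 2 apply: ccvg_sum => ?; exact/ccvgMl/uL.
by apply/funext => k; exact: qE.
Qed.

Lemma mcvg_tr_le u L (m : C) : (forall k, \tr (u k) <= m) -> mcvg u L -> \tr L <= m.
Proof.
move=> um uL; apply: (ccvg_le um).
by apply: ccvg_sum => i; exact: uL.
Qed.

(** The traces form a nondecreasing bounded series, which dominates the real and imaginary parts of
    every entry; these series then converge absolutely, so [mlim] is a genuine limit. *)
Lemma psd_series_mcvg (D : nat -> mx R n) (m : R) :
  (forall i, psd (D i)) ->
  (forall k, complex.Re (\tr (\sum_(i < k) D i)) <= m) ->
  mcvg (fun k => \sum_(i < k) D i) (mlim (fun k => \sum_(i < k) D i)).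
Proof.
move=> Dpsd Dm.
have ReD (a b : C) : complex.Re (a + b) = complex.Re a + complex.Re b by case: a; case: b.
have ImD (a b : C) : complex.Im (a + b) = complex.Im a + complex.Im b by case: a; case: b.
have tr0 i : 0 <= complex.Re (\tr (D i)).
  by have := psd_tr_ge0 (Dpsd i); rewrite lecE => /andP[].
have trE k : series (fun i => complex.Re (\tr (D i))) k = complex.Re (\tr (\sum_(i < k) D i)).
  rewrite /series /= big_mkord [\tr (\sum_(i < k) D i)]linear_sum /=.
  by rewrite (big_morph _ ReD (erefl : complex.Re (0 : C) = 0)).
have cv_tr : cvgn (series (fun i => complex.Re (\tr (D i)))).
  apply: nondecreasing_is_cvgn; first exact: nondecreasing_series.
  by exists m => _ [k _ <-]; rewrite trE.
have cv (f : nat -> R) : (forall i, `|f i| <= complex.Re (\tr (D i))) -> cvgn (series f).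
  move=> fle; apply: normed_cvg; apply: series_le_cvg cv_tr => [k|//|k].
    exact: normr_ge0.
  exact: fle.
move=> a b; rewrite mxE; split.
  rewrite (_ : (fun k => _) = series (fun i => complex.Re (D i a b))).
    by apply: cv => i; have [] := psd_Re_Im_le a b (Dpsd i).
  apply/funext => k; rewrite /series /= big_mkord summxE.
  by rewrite (big_morph _ ReD (erefl : complex.Re (0 : C) = 0)).
rewrite (_ : (fun k => _) = series (fun i => complex.Im (D i a b))).
  by apply: cv => i; have [] := psd_Re_Im_le a b (Dpsd i).
apply/funext => k; rewrite /series /= big_mkord summxE.
by rewrite (big_morph _ ImD (erefl : complex.Im (0 : C) = 0)).
Qed.

End MatrixConvergence.

(** * Program semantics as positive, trace-nonincreasing, additive maps *)

Section PsdMaps.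
Variables (R : realType) (n : nat).
Local Notation C := R[i].
Implicit Types (f g : mx R n -> mx R n) (K M N : mx R n).

(** The laws are asked on psd matrices only, where the limit defining a loop is known to exist. *)
Record psd_map f : Prop := PsdMap {
  psd_map_psd : forall M, psd M -> psd (f M);
  psd_map_tr : forall M, psd M -> \tr (f M) <= \tr M;
  psd_mapD : forall M N, psd M -> psd N -> f (M + N) = f M + f N;
  psd_mapZ : forall (a : C) M, 0 <= a -> psd M -> f (a *: M) = a *: f M }.

Lemma psd_map_comp f g : psd_map f -> psd_map g -> psd_map (g \o f).
Proof.
move=> [fp ft fD fZ] [gp gt gD gZ]; split => /=.
- by move=> M /fp/gp.
- by move=> M hM; exact: le_trans (gt _ (fp _ hM)) (ft _ hM).
- by move=> M N hM hN; rewrite (fD _ _ hM hN) (gD _ _ (fp _ hM) (fp _ hN)).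
- by move=> a M a0 hM; rewrite fZ // gZ //; exact: fp.
Qed.

Lemma psd_map_pdo f M : psd_map f -> pdo M -> pdo (f M).
Proof.
by move=> [fp ft _ _] [hM tM]; split; [exact: fp | exact: le_trans (ft _ hM) tM].
Qed.

Lemma tr_conjmx K M : \tr (K *m M *m adj K) = \tr (adj K *m K *m M).
Proof. by rewrite mxtrace_mulC mulmxA. Qed.

Lemma conjmxD K M N : K *m (M + N) *m adj K = K *m M *m adj K + K *m N *m adj K.
Proof. by rewrite mulmxDr mulmxDl. Qed.

Lemma conjmxZ K a M : K *m (a *: M) *m adj K = a *: (K *m M *m adj K).
Proof. by rewrite -scalemxAr -scalemxAl. Qed.

Lemma psd_map_kraus (I : finType) (K : I -> mx R n) :
  \sum_i adj (K i) *m K i = 1%:M ->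
  psd_map (fun M => \sum_i K i *m M *m adj (K i)).
Proof.
move=> K1; split.
- by move=> M hM; apply: psd_sum => i; exact: psd_conj.
- move=> M _; rewrite linear_sum /= (eq_bigr _ (fun i _ => tr_conjmx (K i) M)).
  by rewrite -linear_sum -mulmx_suml K1 mul1mx.
- by move=> M N _ _; rewrite -big_split; apply: eq_bigr => i _; exact: conjmxD.
- by move=> a M _ _; rewrite scaler_sumr; apply: eq_bigr => i _; exact: conjmxZ.
Qed.

(** By cyclicity and idempotence the two traces are those of [P *m M] and [(1 - P) *m M]: a
    measurement splits the trace exactly between its outcomes. *)
Lemma tr_branch (P : mx R n) M : projector P ->
  \tr (P *m M *m P) + \tr (ocompl P *m M *m ocompl P) = \tr M.
Proof.
move=> [PP _].
have QQ : ocompl P *m ocompl P = ocompl P.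
  by rewrite /ocompl mulmxBl mul1mx mulmxBr mulmx1 PP subrr subr0.
rewrite mxtrace_mulC mulmxA PP [X in _ + X]mxtrace_mulC mulmxA QQ.
by rewrite -linearD /= -mulmxDl /ocompl addrC subrK mul1mx.
Qed.

Lemma projector_ocompl (t : nat) (P : 'M[C]_(dim t)) : projector P -> projector (ocompl P).
Proof.
move=> [PP aP]; split; last by rewrite /ocompl adjB adj_id aP.
by rewrite /ocompl mulmxBl mul1mx mulmxBr mulmx1 PP subrr subr0.
Qed.

Lemma projector_cyl (t : nat) (qs : t.-tuple 'I_n) (P : 'M[C]_(dim t)) :
  uniq qs -> projector P -> projector (cyl qs P).
Proof.
by move=> Uqs [PP aP]; split; [rewrite -cylM // PP | rewrite adj_cyl aP].
Qed.

Lemma cyl_ocompl (t : nat) (qs : t.-tuple 'I_n) (P : 'M[C]_(dim t)) :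
  uniq qs -> cyl qs (ocompl P) = ocompl (cyl qs P).
Proof.
move=> Uqs; apply/eqP; rewrite /ocompl -subr_eq0 opprB addrA -cylD subrK cyl1 //.
by rewrite subrr.
Qed.

Definition pinch (P M : mx R n) := P *m M *m P.

Lemma psd_map_pinch (P : mx R n) : projector P -> psd_map (pinch P).
Proof.
move=> hP; have [_ aP] := hP; have [_ aQ] := projector_ocompl hP; split.
- by move=> M hM; rewrite /pinch -{2}aP; exact: psd_conj.
- move=> M hM; rewrite -(tr_branch M hP) lerDl psd_tr_ge0 // -{2}aQ.
  exact: psd_conj.
- by move=> M N _ _; rewrite /pinch -{2 4 6}aP conjmxD.
- by move=> a M _ _; rewrite /pinch -{2 4}aP conjmxZ.
Qed.

Lemma psd_map_branch (P : mx R n) f g : projector P -> psd_map f -> psd_map g ->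
  psd_map (fun M => f (P *m M *m P) + g (ocompl P *m M *m ocompl P)).
Proof.
move=> hP hf hg; have hQ := projector_ocompl hP.
have [fp ft fD fZ] := psd_map_comp (psd_map_pinch hP) hf.
have [gp gt gD gZ] := psd_map_comp (psd_map_pinch hQ) hg.
split.
- by move=> M hM; apply: psdD; [exact: fp | exact: gp].
- move=> M hM; rewrite linearD /= -(tr_branch M hP); apply: lerD.
    apply: (psd_map_tr hf); exact: (psd_map_psd (psd_map_pinch hP)).
  apply: (psd_map_tr hg); exact: (psd_map_psd (psd_map_pinch hQ)).
- by move=> M N hM hN; rewrite [X in X + _]fD // [X in _ + X]gD // addrACA.
- by move=> a M a0 hM; rewrite [X in X + _]fZ // [X in _ + X]gZ // scalerDr.
Qed.

(** * Loops as limits of their partial sums *)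

Section Loop.
Variables (P : mx R n) (f : mx R n -> mx R n).
Hypotheses (hP : projector P) (hf : psd_map f).

Let g M := f (P *m M *m P).
Let D i M := ocompl P *m iter i g M *m ocompl P.
Let T k M := \sum_(i < k) D i M.

Let hg : psd_map g := psd_map_comp (psd_map_pinch hP) hf.

Let iterg_psd i M : psd M -> psd (iter i g M).
Proof. by move=> hM; elim: i => [|i IHi]; [exact: hM | exact: (psd_map_psd hg)]. Qed.

Let D_map i : psd_map (D i).
Proof.
have : psd_map (iter i g).
  elim: i => [|i IHi]; last exact: psd_map_comp IHi hg.
  by split => //= *; exact: lexx.
by move=> h; exact: psd_map_comp h (psd_map_pinch (projector_ocompl hP)).
Qed.

(** Conservation along the loop: the trace that has left within [k] tests plus the trace still
    inside never grows, since each test splits the trace and the body does not increase it. *)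
Let T_tr k M : psd M -> \tr (T k M) + \tr (iter k g M) <= \tr M.
Proof.
move=> hM; elim: k => [|k IHk]; first by rewrite /T big_ord0 mxtrace0 add0r.
apply: le_trans IHk; rewrite /T big_ord_recr linearD /= -addrA lerD2l.
rewrite -(tr_branch (iter k g M) hP) addrC lerD2r.
apply: (psd_map_tr hf); apply: (psd_map_psd (psd_map_pinch hP)); exact: iterg_psd.
Qed.

Let T_le k M : psd M -> \tr (T k M) <= \tr M.
Proof.
move=> hM; apply: le_trans (T_tr k hM); rewrite lerDl.
by apply: psd_tr_ge0; exact: iterg_psd.
Qed.

Let T_mcvg M : psd M -> mcvg (fun k => T k M) (mlim (fun k => T k M)).
Proof.
move=> hM; apply: (@psd_series_mcvg _ _ (fun i => D i M) (complex.Re (\tr M))) => [i|k].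
  exact: (psd_map_psd (D_map i)).
by have := T_le k hM; rewrite lecE => /andP[].
Qed.

Lemma psd_map_loop : psd_map (fun M => mlim (fun k => T k M)).
Proof.
split.
- move=> M hM; apply: mcvg_psd (T_mcvg hM) => k.
  by apply: psd_sum => i; exact: (psd_map_psd (D_map i)).
- by move=> M hM; apply: mcvg_tr_le (T_mcvg hM) => k; exact: T_le.
- move=> M N hM hN; apply: mlimE.
  rewrite (_ : (fun k => _) = fun k => T k M + T k N).
    by apply: mcvgD; exact: T_mcvg.
  apply/funext => k; rewrite /T -big_split; apply: eq_bigr => i _.
  exact: (psd_mapD (D_map i)).
- move=> a M a0 hM; apply: mlimE.
  rewrite (_ : (fun k => _) = fun k => a *: T k M).
    by apply: mcvgZ; exact: T_mcvg.
  apply/funext => k; rewrite /T scaler_sumr; apply: eq_bigr => i _.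
  exact: (psd_mapZ (D_map i)).
Qed.

End Loop.

Lemma psd_map_sem (c : prog R n) : wf c -> psd_map (sem c).
Proof.
elim: c => [|t qs|t qs U|t qs P|c0 IH0 c1 IH1|t qs P c1 IH1 c0 IH0|t qs P c IH] /=.
- by move=> _; split => //= *; exact: lexx.
- move=> Uqs; apply: (@psd_map_kraus _ (fun x => cyl qs (ketbra R (zero_bits t) x))).
  (* The Kraus operators [|0><x|] satisfy [K* K = |x><x|], and these sum to the identity. *)
  under eq_bigr => x _ do rewrite adj_cyl -cylM // adj_ketbra mul_ketbra.
  by rewrite -(big_morph _ (@cylD _ _ _ qs) (@cyl0 _ _ _ qs)) sum_ketbra cyl1.
- move=> [Uqs [UU _]].
  (* A unitary is a Kraus family with a single member. *)
  have -> : (fun M : mx R n => cyl qs U *m M *m adj (cyl qs U)) =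
      (fun M => \sum_(s : unit) cyl qs U *m M *m adj (cyl qs U)).
    by apply/funext => M; rewrite big_const card_unit /= addr0.
  apply: (@psd_map_kraus _ (fun=> cyl qs U)).
  by rewrite big_const card_unit /= addr0 adj_cyl -cylM // UU cyl1.
- by move=> [Uqs hP]; apply: psd_map_pinch; exact: projector_cyl.
- by move=> [/IH0 h0 /IH1 h1]; exact: psd_map_comp h0 h1.
- move=> [Uqs hP /IH1 h1 /IH0 h0]; rewrite cyl_ocompl //.
  by apply: psd_map_branch => //; exact: projector_cyl.
- move=> [Uqs hP /IH h]; rewrite cyl_ocompl //.
  by apply: psd_map_loop => //; exact: projector_cyl.
Qed.

End PsdMaps.

(** * Weakest preconditions as subspaces *)

Section WeakestPrecondition.
Variables (R : realType) (n : nat) (A : Type).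
Variables (le : A -> A -> Prop) (meet : (A -> Prop) -> A) (sat : mx R n -> A -> Prop).
Hypothesis WS : well_structured le meet sat.
Local Notation C := R[i].

Lemma pdo0 : pdo (0 : mx R n).
Proof. by split; [exact: psd0 | rewrite mxtrace0 ler01]. Qed.

Lemma pdo_half_sum (M N : mx R n) : pdo M -> pdo N -> pdo ((2^-1 : R)%:C%C *: (M + N)).
Proof.
move=> [hM tM] [hN tN]; have h0 : 0 <= ((2^-1 : R)%:C)%C by rewrite ler0c invr_ge0 ler0n.
split; first by apply: psdZ => //; exact: psdD.
rewrite linearZ linearD /=; apply: le_trans (ler_wpM2l h0 (lerD tM tN)) _.
by rewrite -(rmorph1 (real_complex R)) -rmorphD -rmorphM lecR mulVf // pnatr_eq0.
Qed.

(** The zero state is the empty combination, for which the condition on summands is vacuous. *)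
Lemma sat0 a : sat 0 a.
Proof.
have [_ _ _ /(_ a 0 (fun=> 1) (fun=> 0))] := WS.
rewrite big_ord0 => /(_ _ _ pdo0) []; [by case|by case|].
by move=> _; apply; case.
Qed.

Lemma sat_combo (a : A) (x y : R) (M N : mx R n) : 0 < x -> 0 < y -> pdo M -> pdo N ->
  pdo (x%:C%C *: M + y%:C%C *: N) ->
  (sat (x%:C%C *: M + y%:C%C *: N) a <-> sat M a /\ sat N a).
Proof.
move=> x0 y0 hM hN hMN; have [_ _ _ WS4] := WS.
pose z (i : 'I_2) := if val i == 0%N then x else y.
pose L (i : 'I_2) := if val i == 0%N then M else N.
have LE : \sum_(i < 2) (z i)%:C%C *: L i = x%:C%C *: M + y%:C%C *: N.
  by rewrite !big_ord_recl big_ord0 addr0.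
have := WS4 a 2%N z L; rewrite LE => WS2.
have {WS2} [||//|h1 h2] := WS2.
- by move=> i; rewrite /z; case: ifP.
- by move=> i; rewrite /L; case: ifP.
split=> [/h1 h|[sM sN]]; first by split; [have := h ord0 | have := h ord_max].
by apply: h2 => i; rewrite /L; case: ifP.
Qed.

Lemma sat_half_sum (a : A) (M N : mx R n) : pdo M -> pdo N -> sat M a -> sat N a ->
  sat ((2^-1 : R)%:C%C *: (M + N)) a.
Proof.
move=> hM hN sM sN; have := pdo_half_sum hM hN; rewrite scalerDr => h.
by apply/(sat_combo a _ _ hM hN h) => //; rewrite invr_gt0 ltr0n.
Qed.

(* The weakest precondition is the set of states supported on a subspace,
   namely the support of an element of maximal rank. *)
Lemma weakest_precondition_projector (f : mx R n -> mx R n) (b : A) : psd_map f ->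
  exists P : mx R n, [/\ projector P,
    forall M, pdo M -> sat (f (P *m M *m P)) b &
    forall M, pdo M -> sat (f M) b -> P *m M *m P = M].
Proof.
move=> hf; pose W M := pdo M /\ sat (f M) b.
have h2 : 0 < (2^-1 : R) by rewrite invr_gt0 ltr0n.
have f0 : f 0 = 0 by rewrite -(scale0r (0 : mx R n)) (psd_mapZ hf) ?scale0r //; exact: psd0.
have [||M N [hM sM] [hN sN]|S [hS sS] kS] := @max_rank_kermx R n W.
- by exists 0; split; [exact: pdo0 | rewrite f0; exact: sat0].
- by move=> M [[]].
(* The factor 1/2 brings the trace of a sum of two states back to at most 1. *)
- exists ((2^-1 : R)%:C)%C; first by rewrite gt_eqF // ltcR.
  split; first exact: pdo_half_sum.
  have [[pM _] [pN _]] := (hM, hN).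
  rewrite (psd_mapZ hf) ?(psd_mapD hf) ?ler0c ?ltW //; last exact: psdD.
  exact: sat_half_sum (psd_map_pdo hf hM) (psd_map_pdo hf hN) sM sN.
have [P [x [hP x0 hx suppP]]] := support_projector (proj1 hS).
have [PP aP] := hP.
exists P; split=> // M hM; last first.
  move=> sM; have PM := suppP M (proj1 hM) (kS M (conj hM sM)).
  rewrite PM -[RHS](psd_adj (proj1 hM)) -[in RHS]PM adjM aP psd_adj //.
  by case: hM.
pose N := P *m M *m P.
have hN : pdo N by exact: psd_map_pdo (psd_map_pinch hP) hM.
(* [N <= P <= x^-1 S] since [M <= \tr M <= 1] *)
have xC0 : 0 <= (x%:C)%C by rewrite ler0c ltW.
have psdI : psd (1%:M - M).
  have -> : 1%:M - M = (1 - \tr M) *: 1%:M + ((\tr M)%:M - M).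
    by rewrite scalerBl scale1r scalemx1 addrA subrK.
  apply: psdD; last by apply: psd_le_tr; case: hM.
  apply: psdZ; first by rewrite subr_ge0; case: hM.
  by rewrite -diag_const_mx; apply: psd_diag_mx => i; rewrite mxE ler01.
have psdPN : psd (P - N).
  have -> : P - N = P *m (1%:M - M) *m adj P by rewrite aP mulmxBr mulmxBl mulmx1 PP.
  exact: psd_conj.
(* [S = x N + Q] exhibits [N] as a summand of an element of the precondition; [f] carries this to
   [f S = x f N + f Q], and satisfaction of [b] passes from a positive combination to its terms. *)
pose Q := S - x%:C%C *: N.
have psdQ : psd Q.
  have -> : Q = (S - x%:C%C *: P) + x%:C%C *: (P - N).
    by rewrite scalerBr addrA subrK.
  exact: psdD hx (psdZ xC0 psdPN).
have SE : S = x%:C%C *: N + (1 : R)%:C%C *: Q by rewrite scale1r addrC subrK.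
have hQ : pdo Q.
  split=> //; case: hS => _; apply: le_trans; rewrite /Q linearB linearZ /= gerBl.
  exact: mulr_ge0 xC0 (psd_tr_ge0 (proj1 hN)).
have fSE : f S = x%:C%C *: f N + (1 : R)%:C%C *: f Q.
  have [[pN _] [pQ _]] := (hN, hQ).
  have psd1Q : psd ((1 : R)%:C%C *: Q) by apply: psdZ psdQ; rewrite ler0c ler01.
  rewrite SE (psd_mapD hf (psdZ xC0 pN) psd1Q) (psd_mapZ hf xC0 pN).
  by rewrite (psd_mapZ hf _ pQ) // ler0c ler01.
have : pdo (f S) by exact: psd_map_pdo.
rewrite fSE => hfS; have := sS; rewrite fSE.
by case/(sat_combo b x0 ltr01 (psd_map_pdo hf hN) (psd_map_pdo hf hQ) hfS).
Qed.

End WeakestPrecondition.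

(** * Inversion of the sequential rule, and the theorem *)

(** Below any uses of the consequence rule, a derivation for [Seq] must apply the sequential rule,
    whose premises are valid by soundness. Stating the conclusion with validity lets each
    consequence step be absorbed through the meaning of [le]. *)
Lemma derivable_Seq_valid (R : realType) (n : nat) (A : Type)
  (le : A -> A -> Prop) (meet : (A -> Prop) -> A) (sat : mx R n -> A -> Prop)
  (ax : prog R n -> A -> A -> Prop)
  (rif : prog R n -> A -> A -> A -> A -> A -> A -> Prop)
  (rwh : prog R n -> A -> A -> A -> A -> Prop) (a b : A) (c0 c1 : prog R n) :
  well_structured le meet sat -> PS_sound le sat ax rif rwh -> wf c0 -> wf c1 ->
  derivable le ax rif rwh a (Seq c0 c1) b ->
  exists2 a', valid sat a c0 a' & valid sat a' c1 b.
Proof.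
move=> [_ le_sat _ _] PSs wf0 wf1; move Ec : (Seq c0 c1) => c d.
elim: d Ec => {a b c} //.
- by move=> c a b bc _ Ec; rewrite -Ec in bc.
- move=> a a' b d0 d1 h0 _ h1 _ [e0 e1]; rewrite -{}e0 in h0; rewrite -{}e1 in h1.
  by exists a'; exact: PSs.
- move=> a a' b' b c /le_sat aa' _ IH /le_sat bb' /IH[a'' v0 v1].
  exists a'' => rho hrho srho; first by apply: v0 => //; exact: aa'.
  apply: bb'; last exact: v1.
  by apply: psd_map_pdo hrho; exact: psd_map_sem.
Qed.

Theorem mainTheorem12 (R : realType) (n : nat) (A : Type)
  (le : A -> A -> Prop) (meet : (A -> Prop) -> A) (sat : mx R n -> A -> Prop)
  (ax : prog R n -> A -> A -> Prop)
  (rif : prog R n -> A -> A -> A -> A -> A -> A -> Prop)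
  (rwh : prog R n -> A -> A -> A -> A -> Prop) :
  well_structured le meet sat ->
  (PS_sound le sat ax rif rwh ->
     forall c : prog R n, wf c ->
       sound_abstraction le meet sat (sem_set c) (abs_sem le meet ax rif rwh c))
  /\
  (PS_sound le sat ax rif rwh -> PS_rel_complete le sat ax rif rwh ->
     forall c : prog R n, wf c ->
       complete_abstraction meet sat (sem_set c) (abs_sem le meet ax rif rwh c)).
Proof.
move=> WS; have [[_ _ le_anti meet_le le_meet] le_sat sat_meet _] := WS.
have sat_alpha (X : mx R n -> Prop) rho : in_Q X -> X rho -> sat rho (alpha meet sat X).
  by move=> QX Xrho; apply: sat_meet => [|b /(_ _ Xrho)[]]; first exact: QX.
have sound : PS_sound le sat ax rif rwh -> forall c : prog R n, wf c ->
    sound_abstraction le meet sat (sem_set c) (abs_sem le meet ax rif rwh c).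
  move=> PSs c wfc X QX; apply: le_meet => a' /(PSs _ _ _ wfc) va'.
  apply: meet_le => _ [rho Xrho ->]; have hrho := QX _ Xrho.
  split; first by apply: psd_map_pdo hrho; exact: psd_map_sem.
  by apply: va' => //; exact: sat_alpha.
split=> // PSs PSc c wfc X QX; apply: le_anti; first exact: sound.
(* For each [b] satisfied by all outputs from [X], relative completeness reduces the derivability of
   [{alpha X} c {b}] to its validity. *)
apply: le_meet => b hb; apply: (meet_le); apply: (PSc) => //.
have [P [hP preP suppP]] := weakest_precondition_projector WS b (psd_map_sem wfc).
have wfP : wf (Assert (ord_tuple n) P).
  by split; [exact: enum_uniq | exact: hP].
(* The meet of the empty family is the top assertion, which every state satisfies. *)
have [|a' va' vc] := @derivable_Seq_valid _ _ _ _ _ _ _ _ _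
    (meet (fun=> False)) b (Assert (ord_tuple n) P) c WS PSs wfP wfc.
  by apply: PSc => // rho hrho _; rewrite /= cyl_ord_tuple; exact: preP.
move=> rho hrho srho; apply: vc => //.
(* Each [sigma] in [X] lies in the precondition, so [P] fixes it and validity of
   [{top} assert P {a'}] gives that [sigma] satisfies [a']. As [alpha X] is the least assertion
   holding on [X], it lies below [a']. *)
suff /le_sat h : le (alpha meet sat X) a' by exact: h.
apply: meet_le => sigma Xsigma; have hsigma := QX _ Xsigma; split=> //.
have := va' sigma hsigma; rewrite /= cyl_ord_tuple suppP //.
  by apply; apply: sat_meet.
by apply: (proj2 (hb _ _)); exists sigma.
Qed.
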